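(* There exists a finite set of prototiles $\mathcal{F}$ in $\mathbb{R}^2$ such that for every $q\in\mathbb{N}$ there exist $q$ primitive substitution rules $\varrho_1,\dots,\varrho_q$ on $\mathcal{F}$, all with the same substitution matrix, and tilings $\mathcal{T}_1,\dots,\mathcal{T}_q$ with $\mathcal{T}_i\in\mathbb{X}_{\varrho_i}$, such that the Delone sets associated with $\mathcal{T}_1,\dots,\mathcal{T}_q$ are pairwise BD non-equivalent.
   Context: A Delone set in $\mathbb{R}^d$ is a set $\Lambda$ for which there are $r,R>0$ such that every ball of radius $r$ contains at most one point of $\Lambda$ and every ball of radius $R$ contains at least one. Two Delone sets $\Lambda,\Lambda'$ are BD equivalent if there exist $\alpha>0$ and a bijection $\phi:\Lambda\to\alpha\Lambda'$ with $\sup_{x}\|x-\phi(x)\|<\infty$. Tiles are compact sets equal to the closure of their interior; patches are tessellations of bounded sets by tiles with pairwise disjoint interiors, tilings are tessellations of $\mathbb{R}^d$. $\mathcal{F}=\{T_1,\dots,T_n\}$ is a finite set of prototiles and $\mathcal{F}^*$ the set of patches of translates of prototiles up to translation. A substitution rule with inflation factor $\xi>1$ is a map $\varrho:\mathcal{F}\to\mathcal{F}^*$ with $\operatorname{supp}\varrho(T_i)=\xi T_i$, extended to patches tile by tile ($T_i+t\mapsto\varrho(T_i)+\xi t$). $\mathbb{X}_\varrho$ is the set of tilings of $\mathbb{R}^d$ all of whose finite patches are translates of sub-patches of some $\varrho^m(T)$, $m\in\mathbb{N}$, $T\in\mathcal{F}$. The substitution matrix $M_\varrho$ has entries $a_{ij}=$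 number of tiles of type $i$ in $\varrho(T_j)$; $\varrho$ is primitive if some power of $M_\varrho$ is strictly positive. A Delone set is associated with a tiling if it is obtained by choosing one point in each tile, distinct tiles giving distinct points. *)

(* Defs.v *)
From HB Require Import structures.
From mathcomp Require Import all_boot all_order all_algebra.
From mathcomp Require Import all_classical all_reals all_analysis.
Set Implicit Arguments.
Unset Strict Implicit.
Unset Printing Implicit Defensive.
Import Order.TTheory GRing.Theory Num.Theory.
Import numFieldNormedType.Exports.
Local Open Scope classical_set_scope.
Local Open Scope ring_scope.

Section TilingDefs.
Variable R : realType.
Local Notation pt := 'rV[R]_2.

Definition enorm (x : pt) : R := Num.sqrt (\sum_(i < 2) x ord0 i ^+ 2).

Definition eball (c : pt) (r : R) : set pt := [set x | enorm (x - c) < r].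

Definition is_tile (A : set pt) : Prop :=
  compact A /\ closure (interior A) = A /\ A !=set0.

Definition translate (A : set pt) (t : pt) : set pt := (fun x => x + t) @` A.
Definition dilate (xi : R) (A : set pt) : set pt := ( *:%R xi) @` A.

Variable n : nat.
Variable proto : 'I_n -> set pt.

Definition geom (a : 'I_n * pt) : set pt := translate (proto a.1) a.2.

Definition interiors_disjoint (S : set ('I_n * pt)) : Prop :=
  forall a b, S a -> S b -> a <> b ->
    interior (geom a) `&` interior (geom b) = set0.

Definition is_subst (xi : R) (rho : 'I_n -> seq ('I_n * pt)) : Prop :=
  1 < xi /\
  forall i, uniq (rho i) /\
    interiors_disjoint [set a | a \in rho i] /\
    \bigcup_(a in [set a | a \in rho i]) geom a = dilate xi (proto i).

Definition subst_patch (xi : R) (rho : 'I_n -> seq ('I_n * pt))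
    (s : seq ('I_n * pt)) : seq ('I_n * pt) :=
  flatten [seq [seq (b.1, b.2 + xi *: a.2) | b <- rho a.1] | a <- s].

Definition subst_iter (xi : R) (rho : 'I_n -> seq ('I_n * pt)) (m : nat)
    (j : 'I_n) : seq ('I_n * pt) :=
  iter m (subst_patch xi rho) [:: (j, 0)].

Definition subst_matrix (rho : 'I_n -> seq ('I_n * pt)) : 'M[int]_n :=
  \matrix_(i, j) ((count (fun b => b.1 == i) (rho j))%:Z).

Definition primitive (M : 'M[int]_n) : Prop :=
  exists k : nat, (0 < k)%N /\ forall i j, 0 < (M ^+ k) i j.

Definition is_tiling (T : set ('I_n * pt)) : Prop :=
  \bigcup_(a in T) geom a = setT /\ interiors_disjoint T.

Definition in_hull (xi : R) (rho : 'I_n -> seq ('I_n * pt))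
    (T : set ('I_n * pt)) : Prop :=
  is_tiling T /\
  forall s : seq ('I_n * pt), (forall a, a \in s -> T a) ->
    exists (m : nat) (j : 'I_n) (v : pt),
      forall a, a \in s -> (a.1, a.2 + v) \in subst_iter xi rho m j.

Definition associated (T : set ('I_n * pt)) (L : set pt) : Prop :=
  exists f : 'I_n * pt -> pt,
    (forall a, T a -> geom a (f a)) /\
    (forall a b, T a -> T b -> f a = f b -> a = b) /\
    L = f @` T.

End TilingDefs.

Definition Delone (R : realType) (L : set 'rV[R]_2) : Prop :=
  exists r Rr : R, 0 < r /\ 0 < Rr /\
    (forall c x y, L x -> L y -> eball c r x -> eball c r y -> x = y) /\
    (forall c, exists x, L x /\ eball c Rr x).

Definition BD (R : realType) (L L' : set 'rV[R]_2) : Prop :=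
  exists alpha : R, 0 < alpha /\
  exists (phi : 'rV[R]_2 -> 'rV[R]_2) (C : R),
    (forall x, L x -> dilate alpha L' (phi x) /\ enorm (x - phi x) <= C) /\
    (forall x y, L x -> L y -> phi x = phi y -> x = y) /\
    (forall z, dilate alpha L' z -> exists x, L x /\ phi x = z).

(* Main.v *)
Require Import Defs.
From HB Require Import structures.
From mathcomp Require Import all_boot all_order all_algebra.
From mathcomp Require Import all_classical all_reals all_analysis.
From mathcomp Require Import zify ring lra.
Import Order.TTheory GRing.Theory Num.Theory.
Import numFieldNormedType.Exports.
Local Open Scope classical_set_scope.
Local Open Scope ring_scope.

(** Cut the plane into the cells [i, i+1] x [2j, 2j+2]; a cell is either full,
    filled by one tile [0,1] x [0,2], or split into two unit squares, so a
    colouring of Z^2 by full/split is a tiling.  With Q = q + 1 and N = 4 Q, the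
    k-th rule inflates the large tile by N and splits exactly Q of the resulting
    cells, consecutive ones in the bottom row, while the small tile becomes an
    almost completely split pattern.  Sliding the Q split cells does not change
    the substitution matrix, but it changes how many of them, namely k, lie in
    the corner of side Q, hence in the box [-Q, Q)^2 of cells of the fixed
    tiling grown from four full cells around the origin.

    On cells the rule has constant length, and its second eigenvalue is
    lam = N^2 - 2 - Q > N, so the number of split cells in the box of radius
    w N^m is 4 w^2 s_m + lam^m u, where s_m depends on neither w nor k, and u is
    the number of split cells in the box of radius w.  A bounded displacement
    into the dilate by alpha yields an injection between the tiles of two boxes
    whose radii differ by the factor alpha up to a constant.  As lam < N^2, this
    forces alpha = 1; then the tile counts in the box of radius Q N^m differ by
    O(N^m), and lam > N forces the two values of k to agree. *)

(** * Counting over finite rectangles of cells *)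

Lemma sum_nat_mul n k (F : nat -> nat) :
  (\sum_(0 <= i < n * k) F i =
   \sum_(0 <= i < n) \sum_(0 <= r < k) F (i * k + r))%N.
Proof.
rewrite big_nat_mul; apply: eq_bigr => i _.
rewrite -{1}[(i * k)%N]add0n big_addn mulSn addnK.
by apply: eq_bigr => r _; rewrite addnC.
Qed.

Definition cell := (int * int)%type.

Definition rect (x0 y0 : int) (nx ny : nat) : seq cell :=
  [seq ((x0 + i%:Z)%R, (y0 + j%:Z)%R) | i <- iota 0 nx, j <- iota 0 ny].

Definition box (w : nat) : seq cell := rect (- w%:Z) (- w%:Z) (2 * w) (2 * w).

Lemma mem_rect x0 y0 nx ny (z : cell) :
  (z \in rect x0 y0 nx ny) =
  [&& x0 <= z.1, z.1 < x0 + nx%:Z, y0 <= z.2 & z.2 < y0 + ny%:Z].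
Proof.
apply/idP/idP => [/allpairsP[[i j] [/= hi hj ->]]|/and4P[h1 h2 h3 h4]] /=.
  by move: hi hj; rewrite !mem_iota; lia.
apply/allpairsP; exists (`|z.1 - x0|%N, `|z.2 - y0|%N) => /=.
rewrite !mem_iota; split; [lia|lia|].
by case: z h1 h2 h3 h4 => x y /= *; congr pair; lia.
Qed.

Lemma mem_box w (z : cell) :
  (z \in box w) = [&& - w%:Z <= z.1, z.1 < w%:Z, - w%:Z <= z.2 & z.2 < w%:Z].
Proof. by rewrite mem_rect; lia. Qed.

Lemma rect_uniq x0 y0 nx ny : uniq (rect x0 y0 nx ny).
Proof.
apply: allpairs_uniq; [exact: iota_uniq | exact: iota_uniq |].
by move=> [i j] [i' j'] _ _ /= [] /addrI [->] /addrI [->].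
Qed.

Lemma size_rect x0 y0 nx ny : size (rect x0 y0 nx ny) = (nx * ny)%N.
Proof. by rewrite size_allpairs !size_iota. Qed.

Lemma count_rect (c : cell -> bool) x0 y0 nx ny :
  count c (rect x0 y0 nx ny) =
  (\sum_(0 <= i < nx) \sum_(0 <= j < ny) c ((x0 + i%:Z)%R, (y0 + j%:Z)%R))%N.
Proof.
rewrite -sum1_count big_mkcond /rect big_allpairs_dep /= /index_iota !subn0.
by apply: eq_bigr => i _; apply: eq_bigr => j _; case: (c _).
Qed.

Lemma leq_count_box (c : cell -> bool) w w' :
  (w <= w')%N -> (count c (box w) <= count c (box w'))%N.
Proof.
move=> le_ww'; rewrite -!size_filter; apply: uniq_leq_size.
  exact/filter_uniq/rect_uniq.
by move=> z; rewrite !mem_filter !mem_box; case: (c z) => //=; lia.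
Qed.

(** * Substitutive colourings of the lattice *)

Section Coloring.
Variables (N : nat) (p : bool -> cell -> bool).

Definition quo (z : cell) : cell := ((z.1 %/ N)%Z, (z.2 %/ N)%Z).
Definition rem (z : cell) : cell := ((z.1 %% N)%Z, (z.2 %% N)%Z).

Fixpoint color_at (m : nat) (z : cell) : bool :=
  if m is m'.+1 then p (color_at m' (quo z)) (rem z) else false.

(* The number of steps only has to be so large that [z] lies in the box of
   radius [N ^ m], see [coloringE]. *)
Definition coloring (z : cell) : bool := color_at (`|z.1| + `|z.2|)%N z.

Hypothesis N_gt1 : (1 < N)%N.
Hypothesis p_corner : forall z : cell, z \in box 1 -> p false (rem z) = false.

Lemma quo_box w (z : cell) : z \in box (w * N) -> quo z \in box w.
Proof.
rewrite !mem_box /= => /and4P[h1 h2 h3 h4].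
have e1 := divz_eq z.1 N; have e2 := divz_eq z.2 N.
have l1 : (z.1 %% N)%Z < N by apply: ltz_pmod; lia.
have l2 : (z.2 %% N)%Z < N by apply: ltz_pmod; lia.
have g1 : 0 <= (z.1 %% N)%Z by apply: modz_ge0; lia.
have g2 : 0 <= (z.2 %% N)%Z by apply: modz_ge0; lia.
move: (z.1 %/ N)%Z (z.2 %/ N)%Z (z.1 %% N)%Z (z.2 %% N)%Z e1 e2 l1 l2 g1 g2.
move=> a b c d e1 e2 l1 l2 g1 g2; rewrite e1 e2 in h1 h2 h3 h4.
by apply/and4P; split; nia.
Qed.

(** Each [quo] shrinks the box by a factor [N], so after [m] steps [z] has become one of the four
    cells around the origin, where [p_corner] makes one further step harmless. *)
Lemma color_at_stable m (z : cell) : z \in box (N ^ m) -> color_at m.+1 z = color_at m z.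
Proof.
elim: m z => [|m IHm] z; first by rewrite expn0 => hz /=; exact: p_corner.
by rewrite expnSr => /quo_box /IHm /= ->.
Qed.

Lemma color_at_ge m d (z : cell) : z \in box (N ^ m) -> color_at (m + d) z = color_at m z.
Proof.
move=> hz; elim: d => [|d IHd]; first by rewrite addn0.
rewrite addnS color_at_stable //; move: hz; rewrite !mem_box.
have : (N ^ m <= N ^ (m + d))%N by rewrite leq_exp2l // leq_addr.
by move: (N ^ m)%N (N ^ (m + d))%N => a b; lia.
Qed.

Lemma mem_box_abs (z : cell) : z \in box (N ^ (`|z.1| + `|z.2|)).
Proof.
have := ltn_expl (`|z.1| + `|z.2|) N_gt1; rewrite mem_box.
by move: (N ^ _)%N => a; lia.
Qed.

Lemma coloringE m (z : cell) : z \in box (N ^ m) -> coloring z = color_at m z.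
Proof.
move=> hz; rewrite /coloring; set n := (`|z.1| + `|z.2|)%N.
rewrite -(color_at_ge m n z hz) addnC color_at_ge //; exact: mem_box_abs.
Qed.

Lemma coloring_fixed (z : cell) : coloring z = p (coloring (quo z)) (rem z).
Proof.
set m := (`|z.1| + `|z.2|)%N.
have hz : z \in box (N ^ m.+1).
  have := mem_box_abs z; rewrite !mem_box expnS -/m.
  by move: (N ^ m)%N => a; nia.
rewrite (coloringE m.+1 z hz) (coloringE m (quo z)) //.
by apply: quo_box; rewrite -expnSr.
Qed.

Lemma coloring_seed (z : cell) : z \in box 1 -> coloring z = false.
Proof. by move=> hz; rewrite (coloringE 0). Qed.

(** The [N] by [N] block over a cell holds [a] split cells if that cell is full and [a + lam] if it
    is split; sum this over the [(2 * w) ^ 2] cells of the smaller box. *)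
Lemma count_box_mul (a lam w : nat) :
  count (p false) (rect 0 0 N N) = a ->
  count (p true) (rect 0 0 N N) = (a + lam)%N ->
  count coloring (box (w * N)) = (a * (2 * w) ^ 2 + lam * count coloring (box w))%N.
Proof.
move=> h0 h1.
have block (x y : int) :
  (\sum_(0 <= i < N) \sum_(0 <= j < N)
     coloring ((x * N + i)%R, (y * N + j)%R))%N = (a + lam * coloring (x, y))%N.
  have -> : (a + lam * coloring (x, y))%N =
            count (p (coloring (x, y))) (rect 0 0 N N).
    by case: (coloring _); rewrite ?h0 ?h1 ?muln0 ?muln1 ?addn0.
  rewrite count_rect; apply: eq_big_nat => i /andP[_ hi].
  apply: eq_big_nat => j /andP[_ hj].
  rewrite coloring_fixed /quo /rem /= !add0r.
  rewrite !divzMDl ?modzMDl; try lia.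
  rewrite !divz_small ?modz_small ?addr0 //; lia.
have count_box v :
    count coloring (box v) = (\sum_(0 <= i < 2 * v) \sum_(0 <= j < 2 * v)
      coloring ((- v%:Z + i%:Z)%R, (- v%:Z + j%:Z)%R))%N by rewrite count_rect.
rewrite count_box mulnA sum_nat_mul.
transitivity (\sum_(0 <= i < 2 * w) \sum_(0 <= j < 2 * w)
  (a + lam * coloring ((- w%:Z + i%:Z)%R, (- w%:Z + j%:Z)%R)))%N.
  apply: eq_bigr => i _.
  under eq_bigr do rewrite sum_nat_mul.
  rewrite exchange_big /=; apply: eq_bigr => j _.
  rewrite -block; apply: eq_bigr => r _; apply: eq_bigr => s _.
  by congr (nat_of_bool (coloring _)); congr pair; lia.
rewrite count_box big_distrr /=.
under eq_bigr do rewrite big_split /= -big_distrr /= sum_nat_const_nat subn0.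
rewrite big_split /= sum_nat_const_nat subn0; congr addn; lia.
Qed.
End Coloring.

(** * A family of substitutions on full and split cells *)

Lemma count_eq_size (T : eqType) (c : pred T) (s t : seq T) :
  uniq s -> uniq t -> (forall z, (z \in t) = c z && (z \in s)) ->
  count c s = size t.
Proof.
move=> us ut h; rewrite -size_filter; apply/perm_size/uniq_perm => //.
  exact: filter_uniq.
by move=> z; rewrite mem_filter h.
Qed.

(** Bernoulli's inequality [(1 + 1/x)^m >= 1 + m/x], cleared of denominators. It turns a gap of one
    between two bases into an explicit exponent. *)
Lemma leq_expn_succ (x m : nat) : (x ^ m * (x + m) <= x * (x + 1) ^ m)%N.
Proof.
elim: m => [|m IHm]; first by rewrite !expn0; lia.
rewrite !expnS mulnCA; apply: leq_trans (leq_mul (leqnn (x + 1)) IHm).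
by move: (x ^ m)%N => y; nia.
Qed.

Lemma modz_near (N : nat) (x : int) : - N%:Z <= x -> x < N%:Z ->
  (x %% N)%Z = if 0 <= x then x else x + N%:Z.
Proof.
move=> hl hr; case: ifP => hx; first by rewrite modz_small //; lia.
have -> : x = -1 * N%:Z + (x + N%:Z) by lia.
by rewrite modzMDl modz_small; lia.
Qed.

Section Rule.
Variable Q : nat.
Hypothesis Q_gt0 : (0 < Q)%N.

Definition infl : nat := 4 * Q.
Definition second_eig : nat := infl ^ 2 - 2 - Q.

(* [slide k] has [Q] split cells in the bottom row of its square for every [k],
   but exactly [k] of them lie in the corner of side [Q]. *)
Definition slide (k : nat) (r : cell) : bool :=
  [&& r.2 == 0, Q%:Z - k%:Z <= r.1 & r.1 < (2 * Q)%:Z - k%:Z].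

Definition corner (r : cell) : bool := r != (0, 0).

Definition pattern (k : nat) (i : 'I_2) : cell -> bool :=
  if i == ord0 then slide k else corner.

(** A split cell is two stacked small tiles, each inflating to [2 * Q] rows of cells; the reduction
    modulo [2 * Q] places one copy of [corner] above the other. *)
Definition cell_rule (k : nat) (split : bool) (r : cell) : bool :=
  if split then corner (r.1, (r.2 %% (2 * Q)%N)%Z) else slide k r.

Definition col (k : nat) : cell -> bool := coloring infl (cell_rule k).

Definition tile_count (k w : nat) : nat := (4 * w ^ 2 + count (col k) (box w))%N.

(** A margin of one on either side is what [leq_expn_succ] needs, at [x = infl] for the lower bound
    and at [x = second_eig] for the upper one. *)
Lemma second_eig_bounds : (infl + 1 <= second_eig < infl ^ 2)%N.
Proof. by rewrite /second_eig /infl; nia. Qed.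

Lemma infl_gt1 : (1 < infl)%N. Proof. by rewrite /infl; lia. Qed.

Lemma count_slide k : (k < Q)%N -> count (slide k) (rect 0 0 infl infl) = Q.
Proof.
move=> hk; rewrite (count_eq_size _ _ _ (rect (Q%:Z - k%:Z) 0 Q 1)).
- by rewrite size_rect muln1.
- exact: rect_uniq.
- exact: rect_uniq.
- by move=> z; rewrite !mem_rect /slide /infl; lia.
Qed.

Lemma count_corner : (count corner (rect 0 0 infl (2 * Q))).+1 = (8 * Q ^ 2)%N.
Proof.
have := count_predC corner (rect 0 0 infl (2 * Q)).
rewrite (count_eq_size _ (predC corner) _ [:: (0, 0)]) ?rect_uniq //.
  by rewrite size_rect /infl /=; lia.
move=> [x y]; rewrite mem_rect inE /= negbK !xpair_eqE /infl; lia.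
Qed.

(** Each of the two small tiles leaves one full cell, so [infl ^ 2 - 2] cells are split. *)
Lemma count_cell_rule k : (k < Q)%N ->
  count (cell_rule k true) (rect 0 0 infl infl) = (Q + second_eig)%N.
Proof.
move=> hk; have := count_predC (cell_rule k true) (rect 0 0 infl infl).
rewrite (count_eq_size _ (predC (cell_rule k true)) _ [:: (0, 0); (0, (2 * Q)%:Z)]).
- by rewrite size_rect /second_eig /infl /=; nia.
- exact: rect_uniq.
- by rewrite /= inE xpair_eqE; lia.
move=> [x y]; rewrite mem_rect !inE /= negbK !xpair_eqE /infl /=.
case: eqP => //= ->; rewrite lexx /=.
have e := divz_eq y (2 * Q)%N.
have l : (y %% (2 * Q)%N)%Z < (2 * Q)%N by apply: ltz_pmod; lia.
have g : 0 <= (y %% (2 * Q)%N)%Z by apply: modz_ge0; lia.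
have gQ : 0 < (4 * Q)%N%:Z by lia.
rewrite gQ /=; apply/idP/idP => [/orP[]/eqP ey|/andP[/eqP e0 /andP[y0 y1]]].
- by rewrite ey mod0z eqxx /=; lia.
- by rewrite ey modzz eqxx /=; lia.
- move: e; rewrite e0 addr0.
  move: (y %/ _)%Z => d e; rewrite e in y0 y1 *.
  have [/eqP|/eqP] : d = 0 \/ d = 1 by nia.
  + by move/eqP => ->; lia.
  + by move/eqP => ->; lia.
Qed.

(** The remainders of [z] are [0] or [N - 1], the corners of the block. The slid interval starts at
    [Q - k > 0] and ends before [2 * Q], so it misses all four. *)
Lemma cell_rule_corner k z : (k < Q)%N -> z \in box 1 ->
  cell_rule k false (rem infl z) = false.
Proof.
move=> hk; rewrite mem_box /cell_rule /slide /rem /= => hz.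
rewrite !modz_near /infl; try lia.
by do 2 case: ifP => ?; lia.
Qed.

Lemma col_fixed k z : (k < Q)%N ->
  col k z = cell_rule k (col k (quo infl z)) (rem infl z).
Proof.
move=> hk; apply: coloring_fixed => [|y]; first exact: infl_gt1.
exact: cell_rule_corner.
Qed.

Lemma col_seed k z : (k < Q)%N -> z \in box 1 -> col k z = false.
Proof.
move=> hk; apply: coloring_seed => [|y]; first exact: infl_gt1.
exact: cell_rule_corner.
Qed.

(** The box of radius [Q] lies within the four blocks grown from the full seed. The lower blocks
    meet it in their top rows and the upper left one in its last columns, so only the corner of the
    upper right block contributes. *)
Lemma count_col_box k : (k < Q)%N -> count (col k) (box Q) = k.
Proof.
move=> hk; rewrite (count_eq_size _ _ _ (rect (Q%:Z - k%:Z) 0 k 1)).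
- by rewrite size_rect muln1.
- exact: rect_uniq.
- exact: rect_uniq.
move=> z; rewrite mem_rect; have [hz|] := boolP (z \in box Q); last first.
  by rewrite mem_box andbF; lia.
have hq : quo infl z \in box 1.
  by apply: (quo_box _ infl_gt1); move: hz; rewrite !mem_box /infl; lia.
rewrite col_fixed // col_seed // /cell_rule /slide /rem /= andbT.
move: hz; rewrite mem_box => hz.
rewrite !modz_near /infl; try lia.
by do 2 case: ifP => ?; lia.
Qed.

(** [s] is chosen before [k] and [w] because the block counts [Q] and [second_eig] are the same for
    every [k]. *)
Lemma count_scale m : exists s, forall k w, (k < Q)%N ->
  count (col k) (box (w * infl ^ m)) =
  (4 * w ^ 2 * s + second_eig ^ m * count (col k) (box w))%N.
Proof.
elim: m => [|m [s hs]]; first by exists 0%N => k w _; rewrite muln1; lia.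
exists (Q * (infl ^ m) ^ 2 + second_eig * s)%N => k w hk.
rewrite expnSr mulnA (count_box_mul _ _ infl_gt1 _ Q second_eig).
- by rewrite hs // (expnS second_eig); ring.
- by move=> z; exact: cell_rule_corner.
- exact: count_slide.
- exact: count_cell_rule.
Qed.

(** The term [4 * w ^ 2 * infl ^ (2 * m)] decides: reducing [w] by one costs more than the
    [second_eig ^ m] term can return, whatever the two parameters are. This will exclude a dilation
    factor other than 1. *)
Lemma tile_count_shrink k l w m : (k < Q)%N -> (l < Q)%N -> (0 < w)%N ->
  (second_eig * w ^ 2 < m)%N ->
  (tile_count l (w.-1 * infl ^ m) < tile_count k (w * infl ^ m))%N.
Proof.
move=> hk hl w_gt0 hm; rewrite /tile_count.
have [s hs] := count_scale m; rewrite !hs //.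
have hu : (count (col l) (box w.-1) <= 4 * w.-1 ^ 2)%N.
  by apply: leq_trans (count_size _ _) _; rewrite size_rect; lia.
have := leq_expn_succ second_eig m.
have : ((second_eig + 1) ^ m <= (infl ^ m) ^ 2)%N.
  rewrite -expnM mulnC expnM leq_exp2r; last exact: leq_ltn_trans hm.
  by rewrite addn1; case/andP: second_eig_bounds.
have lam_gt0 : (0 < second_eig)%N.
  by case/andP: second_eig_bounds => + _; apply: leq_trans; rewrite addn1.
have : (0 < second_eig ^ m)%N by rewrite expn_gt0 lam_gt0.
move: hm hu lam_gt0; case: w w_gt0 => // w _; rewrite -[w.+1.-1]/w.
move: (count _ (box w)) (count _ (box w.+1)) => u v.
move: (infl ^ m)%N second_eig => y lam hm hu lam_gt0.
move: (lam ^ m)%N ((lam + 1) ^ m)%N => x z x_gt0 hz hx.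
have hxm : (x * (lam + m) <= lam * y ^ 2)%N.
  by apply: leq_trans hx _; rewrite leq_mul2l hz orbT.
(* Here [m > second_eig * w.+1 ^ 2] enters: by Bernoulli the ratio of [infl ^ (2 * m)] to
   [second_eig ^ m] exceeds [w.+1 ^ 2]. *)
have hxw : (x * w.+1 ^ 2 < y ^ 2)%N.
  rewrite -(ltn_pmul2l lam_gt0); apply: leq_trans hxm.
  by rewrite mulnCA ltn_pmul2l //; lia.
have : (x * u <= x * (4 * w ^ 2))%N by rewrite leq_mul2l hu orbT.
move: hxw; rewrite !expnMn !expnS !expn0 !muln1 => hxw xu.
have : (y * y * w.+1 * w.+1 = y * y * w * w + y * y * (2 * w + 1))%N by ring.
nia.
Qed.

(** If [l < k], a surplus of at least [second_eig ^ m] tiles would have to fit in a frame of width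
    [K], which holds only [O(infl ^ m)] of them. *)
Lemma tile_count_shift k l K : (k < Q)%N -> (l < Q)%N ->
  (forall m, tile_count k (Q * infl ^ m) <= tile_count l (Q * infl ^ m + K))%N ->
  (k <= l)%N.
Proof.
move=> hk hl h; rewrite leqNgt; apply/negP => lt_lk.
(* The frame has [8 * w * K + 4 * K ^ 2] cells with at most two tiles each; for [w = Q * infl ^ m]
   this is at most [D * infl ^ m]. The choice of [m] makes Bernoulli exceed that bound. *)
pose D := (16 * Q * K + 8 * K ^ 2)%N.
pose m := (infl * D).+1.
have := h m; rewrite /tile_count.
set w := (Q * infl ^ m)%N.
have full v : (count (col l) (box v) + count (predC (col l)) (box v) = 4 * v ^ 2)%N.
  by rewrite count_predC size_rect; lia.
(* Full cells are not lost when the box grows, so the split cells gained number at most the cells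
   gained. *)
have := leq_count_box (predC (col l)) _ _ (leq_addr K w).
have := full w; have := full (w + K)%N.
have [s hs] := count_scale m.
have ek : count (col k) (box w) = (4 * Q ^ 2 * s + second_eig ^ m * k)%N.
  by rewrite hs // count_col_box.
have el : count (col l) (box w) = (4 * Q ^ 2 * s + second_eig ^ m * l)%N.
  by rewrite hs // count_col_box.
have hlam : (second_eig ^ m * l.+1 <= second_eig ^ m * k)%N.
  by rewrite leq_mul2l lt_lk orbT.
move=> e1 e2 e3 e4.
have hD : (second_eig ^ m <= 16 * w * K + 8 * K ^ 2)%N by nia.
have hpow : ((infl + 1) ^ m <= second_eig ^ m)%N.
  by rewrite leq_exp2r //; case/andP: second_eig_bounds.
have hb := leq_expn_succ infl m.
have y_gt0 : (0 < infl ^ m)%N by rewrite expn_gt0 (ltnW infl_gt1).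
have : (16 * w * K + 8 * K ^ 2 <= infl ^ m * D)%N.
  rewrite /D mulnDr leq_add // /w; last by rewrite leq_pmull.
  by apply/eq_leq; ring.
move=> hwD.
have {}hb : (infl ^ m * (infl + m) <= infl ^ m * (infl * D))%N.
  apply: leq_trans hb _; rewrite mulnCA leq_mul2l.
  by rewrite (leq_trans hpow (leq_trans hD hwD)) orbT.
by move: hb; rewrite leq_pmul2l // leqNgt /m addnS ltnS leq_addl.
Qed.
End Rule.

(** * Rectangles in the plane *)

Section Geometry.
Variable R : realType.
Implicit Type x : 'rV[R]_2.

Definition crect (a b : 'rV[R]_2) : set 'rV[R]_2 :=
  [set x | forall j, a ord0 j <= x ord0 j <= b ord0 j].

Lemma interior_crect_lt a b x : interior (crect a b) x ->
  forall j, a ord0 j < x ord0 j < b ord0 j.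
Proof.
rewrite /interior /= => /nbhs_ballP[e /= e0 he] j.
have hx (t : R) : `|t| < e -> crect a b (x + const_mx t).
  move=> ht; apply: he; split=> // i' j'; rewrite /ball /= !mxE.
  by rewrite opprD addrA subrr add0r normrN.
have he2 : `|e / 2| < e by rewrite ger0_norm; lra.
have := hx _ he2 j; rewrite -normrN in he2; have := hx _ he2 j.
by rewrite !mxE; lra.
Qed.

Lemma lt_interior_crect (a b : 'rV[R]_2) x :
  (forall j, a ord0 j < x ord0 j < b ord0 j) -> interior (crect a b) x.
Proof.
move=> hx; rewrite /interior /=.
pose e := \big[Num.min/1]_j Num.min (x ord0 j - a ord0 j) (b ord0 j - x ord0 j).
have e0 : 0 < e.
  rewrite /e; elim/big_ind: _ => [//|u v u0 v0|j _]; first by rewrite lt_min u0.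
  by have := hx j; rewrite lt_min; lra.
apply/nbhs_ballP; exists e => //= y [_ hy] j.
have := hy ord0 j; rewrite /ball /= => hyj.
have : e <= Num.min (x ord0 j - a ord0 j) (b ord0 j - x ord0 j).
  by rewrite /e (bigD1 j) //= ge_min lexx.
by rewrite le_min; move: hyj; rewrite ltr_norml; lra.
Qed.

Lemma crect_compact a b : compact (crect a b).
Proof.
have := @rV_compact R 2 (fun j => `[a ord0 j, b ord0 j]%classic) (fun j => @segment_compact R _ _).
by congr compact; apply/seteqP; split=> x hx j; have := hx j; rewrite /= in_itv.
Qed.

Lemma crect_is_tile (a b : 'rV[R]_2) : (forall j, a ord0 j < b ord0 j) -> is_tile (crect a b).
Proof.
move=> hab; split; first exact: crect_compact.
split; last by exists a => j; rewrite lexx ltW.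
apply/seteqP; split => [x hx|x hx].
  have cl : closed (crect a b).
    by apply: compact_closed; [exact: norm_hausdorff | exact: crect_compact].
  by apply: cl; apply: closureS hx; exact: interior_subset.
move=> B /nbhs_ballP[e /= e0 he].
(* A point of the rectangle is moved towards the centre by a fraction [t]. As [M] exceeds every
   side, [t * M <= e] keeps it within [e], while [t > 0] makes all inequalities strict. *)
pose M := 1 + \sum_j (b ord0 j - a ord0 j).
have hM j : b ord0 j - a ord0 j < M.
  rewrite /M (bigD1 j) //=; have : 0 <= \sum_(i < 2 | i != j) (b ord0 i - a ord0 i).
    by apply: sumr_ge0 => i _; have := hab i; lra.
  lra.
have M0 : 0 < M by have := hM ord0; have := hab ord0; lra.
pose t := Num.min 1 (e / M).
have t0 : 0 < t by rewrite lt_min ltr01 divr_gt0.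
have t1 : t <= 1 by rewrite ge_min lexx.
have tM : t * M <= e by rewrite -ler_pdivlMr // ge_min lexx orbT.
pose y := x + t *: (2^-1 *: (a + b) - x).
have yE j : y ord0 j = x ord0 j + t * (2^-1 * (a ord0 j + b ord0 j) - x ord0 j).
  by rewrite !mxE.
exists y; split.
  by apply: lt_interior_crect => j; rewrite yE; have := hx j; have := hab j; nra.
apply: he; split=> // i j; rewrite (ord1 i) /ball /= yE.
have := hx j; have := hab j; have := hM j.
by rewrite ltr_norml; nra.
Qed.

Lemma coord_le_enorm x j : `|x ord0 j| <= enorm x.
Proof.
rewrite -sqrtr_sqr ler_wsqrtr // (bigD1 j) //= lerDl.
by apply: sumr_ge0 => i _; exact: sqr_ge0.
Qed.

Lemma ord2_ind (P : 'I_2 -> Prop) : P ord0 -> P ord_max -> forall j, P j.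
Proof.
move=> P0 P1 [[|[|j]] hj] //.
  by have -> : Ordinal hj = ord0 by apply: val_inj.
by have -> : Ordinal hj = ord_max by apply: val_inj.
Qed.

Implicit Types (n : nat) (i : 'I_2) (c : cell -> bool) (z : cell).

Lemma ord2_neq0_inj (i j : 'I_2) : (i != ord0) = (j != ord0) -> i = j.
Proof. by elim/ord2_ind: i; elim/ord2_ind: j. Qed.

Definition pt (x y : int) : 'rV[R]_2 := \row_j (if j == ord0 then x else y)%:~R.

Lemma pt0 (x y : int) : pt x y ord0 ord0 = x%:~R. Proof. by rewrite mxE. Qed.
Lemma pt1 (x y : int) : pt x y ord0 ord_max = y%:~R. Proof. by rewrite mxE. Qed.

Lemma pt_inj (x y x' y' : int) : pt x y = pt x' y' -> x = x' /\ y = y'.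
Proof.
move=> e; split; apply: (@intr_inj R).
  by rewrite -(pt0 x y) e pt0.
by rewrite -(pt1 x y) e pt1.
Qed.

Lemma ptD (x y x' y' : int) : pt x y + pt x' y' = pt (x + x') (y + y').
Proof. by apply/rowP; elim/ord2_ind; rewrite !mxE /= rmorphD. Qed.

Lemma ptZ n (x y : int) : n%:R *: pt x y = pt (n%:Z * x) (n%:Z * y).
Proof. by apply/rowP; elim/ord2_ind; rewrite !mxE /= rmorphM. Qed.

(** * Tilings of the plane from colourings *)

Definition height (i : 'I_2) : int := if i == ord0 then 2 else 1.

Definition proto (i : 'I_2) : set 'rV[R]_2 := crect 0 (pt 1 (height i)).

Lemma proto_is_tile i : is_tile (proto i).
Proof.
apply: crect_is_tile; elim/ord2_ind; rewrite ?pt0 ?pt1 mxE ltr0z //.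
by rewrite /height; case: ifP.
Qed.

Lemma geom_proto i v : geom proto (i, v) = crect v (v + pt 1 (height i)).
Proof.
apply/seteqP; split => [_ [x hx <-] j|x hx].
  by have := hx j; rewrite !mxE /=; lra.
exists (x - v); last by rewrite /= subrK.
by move=> j; have := hx j; rewrite !mxE /=; lra.
Qed.

Lemma mem_geom_pt i (x y : int) p : geom proto (i, pt x y) p <->
  (x%:~R <= p ord0 ord0 <= (x + 1)%:~R) /\
  (y%:~R <= p ord0 ord_max <= (y + height i)%:~R).
Proof.
rewrite geom_proto ptD; split => [hp|[h0 h1]].
  by have := hp ord0; have := hp ord_max; rewrite !pt0 !pt1.
by elim/ord2_ind; rewrite ?pt0 ?pt1.
Qed.

Lemma dilate_proto n i : (0 < n)%N ->
  dilate n%:R (proto i) = crect 0 (pt n (n%:Z * height i)).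
Proof.
move=> n0; have n0R : 0 < n%:R :> R by rewrite ltr0n.
have e : pt n (n%:Z * height i) = n%:R *: pt 1 (height i) by rewrite ptZ mulr1.
have scE (t : R) (v : 'rV[R]_2) j : (t *: v) ord0 j = t * v ord0 j by rewrite mxE.
rewrite e; apply/seteqP; split => [_ [x hx <-] j|x hx].
  by have := hx j; rewrite !scE mxE; nra.
exists (n%:R^-1 *: x); last by rewrite /= scalerA divff ?scale1r ?gt_eqF.
move=> j; have := hx j; rewrite !scE [_ ord0 j]mxE.
by rewrite ler_pdivlMl // mulr0 ler_pdivrMl.
Qed.

Definition tiles (c : cell -> bool) (z : cell) : seq ('I_2 * 'rV[R]_2) :=
  if c z then [:: (ord_max, pt z.1 (2 * z.2)); (ord_max, pt z.1 (2 * z.2 + 1))]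
  else [:: (ord0, pt z.1 (2 * z.2))].

Definition patch (c : cell -> bool) (cs : seq cell) : seq ('I_2 * 'rV[R]_2) :=
  flatten [seq tiles c z | z <- cs].

Definition tiling (c : cell -> bool) : set ('I_2 * 'rV[R]_2) :=
  [set a | exists z, a \in tiles c z].

(** One description for both kinds of cell: the inequalities on [y] leave one position for a large
    tile and two for a small one. *)
Lemma tilesP c z a : reflect
  (exists i y, [/\ a = (i, pt z.1 y), c z = (i != ord0), 2 * z.2 <= y
                 & y + height i <= 2 * z.2 + 2])
  (a \in tiles c z).
Proof.
apply: (iffP idP); rewrite /tiles.
  case: ifP => hc; rewrite !inE; last by move/eqP ->; exists ord0, (2 * z.2); split.
  by case/orP => /eqP ->; exists ord_max; eexists; split; try reflexivity;
     rewrite ?hc /height /=; lia.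
case=> i [y [-> ->]]; rewrite /height; elim/ord2_ind: i => /= h1 h2.
  have -> : y = 2 * z.2 by lia.
  by rewrite inE.
have [->|->] : y = 2 * z.2 \/ y = 2 * z.2 + 1 by lia.
  by rewrite !inE eqxx.
by rewrite !inE eqxx orbT.
Qed.

Lemma patchP c cs a : reflect (exists2 z, z \in cs & a \in tiles c z) (a \in patch c cs).
Proof. exact: flatten_mapP. Qed.

Lemma patch_tiling c cs a : a \in patch c cs -> tiling c a.
Proof. by case/patchP => z _ ha; exists z. Qed.

Lemma tiles_cell c z z' a : a \in tiles c z -> a \in tiles c z' -> z = z'.
Proof.
case/tilesP => i [y [-> _ h1 h2]] /tilesP[i' [y' [+ _ h3 h4]]].
case=> ei /pt_inj[e1 e2]; rewrite -ei in h4; case: z z' e1 h1 h2 h3 h4 => u j [u' j'] /= -> h1 h2 h3 h4.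
by congr pair; move: h2 h4; rewrite /height -e2; case: ifP; lia.
Qed.

Lemma patch_uniq c cs : uniq cs -> uniq (patch c cs).
Proof.
elim: cs => //= z cs IHcs /andP[hz /IHcs u]; rewrite /patch /= cat_uniq u andbT.
apply/andP; split.
  rewrite /tiles; case: ifP => //= _; rewrite inE andbT; apply/eqP => -[].
  by case/pt_inj; lia.
apply/hasPn => a /patchP[z' hz' ha']; apply/negP => ha.
by rewrite (tiles_cell c z z' a) ?hz' in hz.
Qed.

Lemma count_patch c cs i : count (fun a => a.1 == i) (patch c cs) =
  (if i == ord0 then count (predC c) cs else 2 * count c cs)%N.
Proof.
rewrite /patch; elim: cs => [|z cs IHcs] /=; first by rewrite if_same.
rewrite count_cat IHcs /tiles.
by elim/ord2_ind: i {IHcs} => /=; case: (c z) => /=; lia.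
Qed.

Lemma size_patch c cs : size (patch c cs) = (size cs + count c cs)%N.
Proof.
rewrite /patch; elim: cs => //= z cs IHcs; rewrite size_cat IHcs /tiles.
by case: (c z) => /=; lia.
Qed.

(** A common interior point gives strict inequalities between integer corners. These force the same
    cell, hence by the colouring the same type, hence the same height. *)
Lemma tiling_disjoint c : interiors_disjoint proto (tiling c).
Proof.
move=> a b [z /tilesP[i [y [-> hc h1 h2]]]] [z' /tilesP[i' [y' [-> hc' h3 h4]]]] ne.
apply/seteqP; split=> // p [] /=; rewrite !geom_proto !ptD.
move=> /interior_crect_lt hp /interior_crect_lt hp'.
have [[l1 l2] [l3 l4]] : (z.1 < z'.1 + 1 /\ z'.1 < z.1 + 1) /\
    (y < y' + height i' /\ y' < y + height i).
  have := hp ord0; have := hp' ord0; have := hp ord_max; have := hp' ord_max.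
  rewrite !pt0 !pt1 => /andP[q1 q2] /andP[q3 q4] /andP[q5 q6] /andP[q7 q8].
  rewrite -!(ltr_int R); split; split.
  - exact: lt_trans q7 q6.
  - exact: lt_trans q5 q8.
  - exact: lt_trans q3 q2.
  - exact: lt_trans q1 q4.
move: hp hp' => _ _; have e : z = z'.
  case: z z' {ne hc hc'} h1 h2 h3 h4 l1 l2 l3 l4 => u j [u' j'] /= *.
  by congr pair; lia.
apply: ne; rewrite -e in hc' h3 h4 *.
have ei : i = i' by apply: ord2_neq0_inj; rewrite -hc.
rewrite -ei in h4 l3 l4 *; congr (_, pt _ _).
by clear - h1 h2 h3 h4 l3 l4; move: h2 h4 l3 l4; rewrite /height; case: ifP; lia.
Qed.

Lemma unit_interval (n : nat) (x : R) : 0 <= x -> x <= n%:R -> (0 < n)%N ->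
  exists u : int, [/\ 0 <= u, u < n%:Z & u%:~R <= x <= (u + 1)%:~R].
Proof.
(* At the right end [x = n] the floor would leave the range, so the last interval is taken. *)
move=> x0 xn n0; have [xe|ne] := eqVneq x n%:R.
  exists (n%:Z - 1); split; [lia|lia|].
  by rewrite xe subrK pmulrn lexx andbT ler_int; lia.
exists (Num.floor x); have /andP[f1 f2] := floor_itv x.
split; first by rewrite floor_ge_int.
  by rewrite -(ltr_int R); apply: le_lt_trans f1 _; rewrite lt_neqAle ne.
by rewrite f1 ltW.
Qed.

Lemma tiles_cover c (x y : int) (p : 'rV[R]_2) :
  x%:~R <= p ord0 ord0 <= (x + 1)%:~R ->
  y%:~R <= p ord0 ord_max <= (y + 1)%:~R ->
  exists2 a, a \in tiles c (x, (y %/ 2)%Z) & geom proto a p.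
Proof.
move=> hx /andP[hy1 hy2]; case hc: (c (x, (y %/ 2)%Z)).
  exists (ord_max, pt x y); last by apply/mem_geom_pt; rewrite hy1 hy2 hx.
  by apply/tilesP; exists ord_max, y; rewrite hc /height /=; split=> //; lia.
exists (ord0, pt x (2 * (y %/ 2)%Z)).
  by apply/tilesP; exists ord0; eexists; rewrite hc /height /=; split=> //; lia.
apply/mem_geom_pt; split=> //; rewrite /height /=; apply/andP; split.
  by apply: le_trans hy1; rewrite ler_int; lia.
by apply: le_trans hy2 _; rewrite ler_int; lia.
Qed.

Lemma tiles_bound c z a p : a \in tiles c z -> geom proto a p ->
  z.1%:~R <= p ord0 ord0 <= (z.1 + 1)%:~R /\
  (2 * z.2)%:~R <= p ord0 ord_max <= (2 * z.2 + 2)%:~R.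
Proof.
case/tilesP => i [y [-> _ h1 h2]] /mem_geom_pt[hx /andP[hy1 hy2]]; split=> //.
apply/andP; split.
  by apply: le_trans hy1; rewrite ler_int.
by apply: le_trans hy2 _; rewrite ler_int.
Qed.

Lemma is_tiling_tiling c : is_tiling proto (tiling c).
Proof.
split; last exact: tiling_disjoint.
apply/seteqP; split=> // p _.
have /andP[x1 x2] := floor_itv (p ord0 ord0).
have /andP[y1 y2] := floor_itv (p ord0 ord_max).
have [||a ha hp] := tiles_cover c (Num.floor (p ord0 ord0)) (Num.floor (p ord0 ord_max)) p.
- by rewrite x1 ltW.
- by rewrite y1 ltW.
by exists a => //; eexists; exact: ha.
Qed.

(** * The substitution rules and their fixed tilings *)

Section Substitution.
Variable Q : nat.
Hypothesis Q_gt0 : (0 < Q)%N.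

Local Notation N := (infl Q).

(** Cells have height 2, so the inflated tile has half as many rows as its height; [infl] being
    even, this also works for the small tile. *)
Definition rows (i : 'I_2) : nat := if i == ord0 then N else (2 * Q)%N.

Definition subst (k : nat) (i : 'I_2) : seq ('I_2 * 'rV[R]_2) :=
  patch (pattern Q k i) (rect 0 0 N (rows i)).

Lemma double_rows i : (2 * rows i)%:Z = N%:Z * height i.
Proof. by rewrite /rows /height /infl; case: ifP; lia. Qed.

Lemma is_subst_subst k : is_subst proto N%:R (subst k).
Proof.
have N1 := infl_gt1 Q Q_gt0.
split; first by rewrite ltr1n.
move=> i; split; first exact/patch_uniq/rect_uniq.
split; first by move=> a b /patch_tiling ha /patch_tiling hb; exact: tiling_disjoint ha hb.
have hrows := double_rows i.
have rows0 : (0 < rows i)%N by rewrite /rows /infl; case: ifP; lia.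
rewrite dilate_proto ?(ltnW N1) // -hrows; apply/seteqP; split => [p [a ha hp]|p hp].
  move: ha => /= /patchP[z]; rewrite mem_rect => /and4P[z1 z2 z3 z4] ha.
  have [/andP[q1 q2] /andP[q3 q4]] := tiles_bound _ _ _ _ ha hp.
  elim/ord2_ind; rewrite ?pt0 ?pt1 mxE; apply/andP; split.
  - by apply: le_trans q1; rewrite ler0z.
  - by apply: le_trans q2 _; rewrite ler_int; lia.
  - by apply: le_trans q3; rewrite ler0z; lia.
  - by apply: le_trans q4 _; rewrite ler_int; lia.
have := hp ord0; have := hp ord_max; rewrite !mxE /= => /andP[q1 q2] /andP[q3 q4].
have [|||x [x0 x1 hx]] := unit_interval N (p ord0 ord0); rewrite ?(ltnW N1) //.
have [|||y [y0 y1 hy]] := unit_interval (2 * rows i) (p ord0 ord_max); rewrite ?muln_gt0 //.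
have [a ha hap] := tiles_cover (pattern Q k i) x y p hx hy.
exists a => //=; apply/patchP; eexists; last exact: ha.
by rewrite mem_rect /=; lia.
Qed.

Lemma subst_matrix_subst k l : (k < Q)%N -> (l < Q)%N ->
  subst_matrix (subst k) = subst_matrix (subst l).
Proof.
move=> hk hl; apply/matrixP => i j; rewrite !mxE !count_patch.
have e : count (pattern Q k j) (rect 0 0 N (rows j)) =
         count (pattern Q l j) (rect 0 0 N (rows j)).
  elim/ord2_ind: j; rewrite /pattern /rows //=.
  by rewrite !count_slide.
congr Posz; case: ifP => _; last by rewrite e.
have := count_predC (pattern Q k j) (rect 0 0 N (rows j)).
have := count_predC (pattern Q l j) (rect 0 0 N (rows j)).
by rewrite e; lia.
Qed.

(** The first power suffices, since every pattern contains both full and split cells. *)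
Lemma primitive_subst k : (k < Q)%N -> primitive (subst_matrix (subst k)).
Proof.
move=> hk; exists 1%N; split=> // i j; rewrite expr1 mxE count_patch ltz_nat.
have hs := count_slide Q Q_gt0 k hk; have hc := count_corner Q Q_gt0.
have := count_predC (pattern Q k j) (rect 0 0 N (rows j)).
elim/ord2_ind: j; rewrite /pattern /rows /= size_rect.
  rewrite hs; have -> : (N * N = 16 * Q * Q)%N by rewrite /infl; ring.
  by case: ifP => _; nia.
have -> : (N * (2 * Q) = 8 * Q ^ 2)%N by rewrite /infl; ring.
by rewrite -hc; case: ifP => _; nia.
Qed.

Lemma subst_iterS k m j : subst_iter N%:R (subst k) m.+1 j =
  subst_patch N%:R (subst k) (subst_iter N%:R (subst k) m j).
Proof. by []. Qed.

Lemma mem_subst_patch k s a b : a \in s -> b \in subst k a.1 ->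
  (b.1, b.2 + N%:R *: a.2) \in subst_patch N%:R (subst k) s.
Proof.
move=> ha hb; apply/flatten_mapP; exists a => //.
by apply/mapP; exists b.
Qed.

Lemma tiles_desubst k m z a : (k < Q)%N -> z \in box (N ^ m.+1) ->
  a \in tiles (col Q k) z ->
  exists z' a' b, [/\ z' \in box (N ^ m), a' \in tiles (col Q k) z',
    b \in subst k a'.1 & a = (b.1, b.2 + N%:R *: a'.2)].
Proof.
move=> hk hz /tilesP[i [y [-> hc h1 h2]]].
have N1 := infl_gt1 Q Q_gt0.
have hq : quo N z \in box (N ^ m) by apply: (quo_box _ N1); rewrite -expnSr.
rewrite col_fixed // in hc.
have e1 := divz_eq z.1 N; have e2 := divz_eq z.2 N.
have l1 : (z.1 %% N)%Z < N%:Z by apply: ltz_pmod; lia.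
have l2 : (z.2 %% N)%Z < N%:Z by apply: ltz_pmod; lia.
have g1 : 0 <= (z.1 %% N)%Z by apply: modz_ge0; lia.
have g2 : 0 <= (z.2 %% N)%Z by apply: modz_ge0; lia.
exists (quo N z).
set x' := (z.1 %/ N)%Z in e1; set y' := (z.2 %/ N)%Z in e2.
set r1 := (z.1 %% N)%Z in e1 l1 g1; set r2 := (z.2 %% N)%Z in e2 l2 g2.
have {hc} : (i != ord0) = cell_rule Q k (col Q k (quo N z)) (r1, r2) by rewrite -hc.
case hp : (col Q k (quo N z)) => /= hc.
  (* The parent cell is split; [d] tells which of its two small tiles, lower or upper, produced the
     given tile. *)
  pose d := (r2 %/ (2 * Q)%N)%Z.
  have e3 : r2 = d * (2 * Q)%N + (r2 %% (2 * Q)%N)%Z by exact: divz_eq.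
  have l3 : (r2 %% (2 * Q)%N)%Z < (2 * Q)%N by apply: ltz_pmod; lia.
  have g3 : 0 <= (r2 %% (2 * Q)%N)%Z by apply: modz_ge0; lia.
  set r3 := (r2 %% (2 * Q)%N)%Z in hc e3 l3 g3.
  have hN : N = (4 * Q)%N by [].
  have hd : d = 0 \/ d = 1 by rewrite hN in l2; nia.
  exists (ord_max, pt x' (2 * y' + d)), (i, pt r1 (y - N%:Z * (2 * y' + d))).
  split=> //.
  - by apply/tilesP; exists ord_max, (2 * y' + d); rewrite hp /height /=; split=> //; lia.
  - apply/patchP; exists (r1, r3).
      by rewrite mem_rect /rows /= hN; lia.
    apply/tilesP; exists i; eexists; split; [reflexivity| by rewrite hc | |] => /=.
      by rewrite e2 in h1; nia.
    by rewrite e2 in h2; nia.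
  - by rewrite ptZ ptD /=; congr (_, pt _ _); [rewrite e1; ring | ring].
exists (ord0, pt x' (2 * y')), (i, pt r1 (y - N%:Z * (2 * y'))).
split=> //.
- by apply/tilesP; exists ord0, (2 * y'); rewrite hp /height /=; split=> //; lia.
- apply/patchP; exists (r1, r2); first by rewrite mem_rect /rows /=; lia.
  apply/tilesP; exists i; eexists; split; [reflexivity| by rewrite hc | |] => /=.
    by rewrite e2 in h1; nia.
  by rewrite e2 in h2; nia.
- by rewrite ptZ ptD /=; congr (_, pt _ _); [rewrite e1; ring | ring].
Qed.

(* The seed, four full cells around the origin, occurs in [subst k ord0] around
   the lower left corner of the cell [(1, 2)]. *)
Lemma tiles_subst_iter k m z a : (k < Q)%N -> z \in box (N ^ m) ->
  a \in tiles (col Q k) z ->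
  (a.1, a.2 + (N ^ m)%N%:R *: pt 1 4) \in subst_iter N%:R (subst k) m.+1 ord0.
Proof.
move=> hk; elim: m z a => [|m IHm] z a hz ha; last first.
  have [z' [a' [b [hz' ha' hb ->]]]] := tiles_desubst k m z a hk hz ha.
  have := mem_subst_patch k _ _ b (IHm z' a' hz' ha') hb.
  by rewrite subst_iterS scalerDr scalerA -natrM -expnS addrA.
rewrite expn0 in hz; rewrite scale1r.
have -> : a = (ord0, pt z.1 (2 * z.2)).
  by move: ha; rewrite /tiles col_seed // inE => /eqP.
have := mem_subst_patch k [:: (ord0, 0)] (ord0, 0) (ord0, pt (z.1 + 1) (2 * z.2 + 4)).
rewrite /= ptD scaler0 addr0; apply; first by rewrite inE.
move: hz; rewrite mem_box => hz.
apply/patchP; exists (z.1 + 1, z.2 + 2).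
  by rewrite mem_rect /rows /= /infl; lia.
apply/tilesP; exists ord0; eexists; split; [reflexivity| | |] => /=.
(* The seed lands in rows 1 and 2, above the bottom row that holds the split cells. *)
- by rewrite /pattern /slide /=; lia.
- lia.
- by rewrite /height /=; lia.
Qed.

Lemma in_hull_tiling k : (k < Q)%N ->
  in_hull proto N%:R (subst k) (tiling (col Q k)).
Proof.
move=> hk; split; first exact: is_tiling_tiling.
move=> s hs.
have [m hm] : exists m, forall a, a \in s ->
    exists2 z, z \in box (N ^ m) & a \in tiles (col Q k) z.
  elim: s hs => [|a s IHs] hs; first by exists 0%N.
  have [|m hm] := IHs; first by move=> b hb; apply: hs; rewrite inE hb orbT.
  have [z hz] := hs a (mem_head _ _).
  (* The sum of the exponents dominates both, so one box contains the new tile and all earlier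
     ones. *)
  exists (m + (`|z.1| + `|z.2|))%N => b; rewrite inE => /orP[/eqP ->|/hm[z' hz' hb]].
    exists z => //; have := mem_box_abs N (infl_gt1 Q Q_gt0) z; rewrite !mem_box.
    have : (N ^ (`|z.1| + `|z.2|) <= N ^ (m + (`|z.1| + `|z.2|)))%N.
      by rewrite leq_exp2l ?leq_addl // infl_gt1.
    by move: (N ^ _)%N (N ^ _)%N => u v; lia.
  exists z' => //; move: hz'; rewrite !mem_box.
  have : (N ^ m <= N ^ (m + (`|z.1| + `|z.2|)))%N.
    by rewrite leq_exp2l ?leq_addr // infl_gt1.
  by move: (N ^ m)%N (N ^ _)%N => u v; lia.
exists m.+1, ord0, ((N ^ m)%N%:R *: pt 1 4) => a /hm[z hz ha].
exact: tiles_subst_iter ha.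
Qed.
End Substitution.

(** * Bounded displacement between the tilings *)

Section Displacement.
Variables (c c' : cell -> bool) (f f' : 'I_2 * 'rV[R]_2 -> 'rV[R]_2).
Hypothesis f_geom : forall a, tiling c a -> geom proto a (f a).
Hypothesis f'_geom : forall a, tiling c' a -> geom proto a (f' a).

(** A tile in the box of radius [W] is matched to one in the box of radius [W']: [C] pays for the
    displacement and [alpha] for the position of the point inside its dilated cell. *)
Lemma displacement_size (alpha C : R) h W W' : 0 < alpha -> 0 <= C ->
  (forall a, tiling c a -> tiling c' (h a)) ->
  (forall a b, tiling c a -> tiling c b -> h a = h b -> a = b) ->
  (forall a, tiling c a -> enorm (f a - alpha *: f' (h a)) <= C) ->
  W%:R + C + alpha < alpha * W'%:R ->
  (size (patch c (box W)) <= size (patch c' (box W')))%N.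
Proof.
move=> alpha0 C0 hT hinj hC hW.
rewrite -(size_map h); apply: uniq_leq_size.
  rewrite map_inj_in_uniq; first exact/patch_uniq/rect_uniq.
  by move=> a b /patch_tiling ha /patch_tiling hb; exact: hinj.
move=> _ /mapP[a ha ->]; have Ta := patch_tiling _ _ _ ha.
have [z' hz'] := hT a Ta; apply/patchP; exists z' => //.
case/patchP: ha => z; rewrite mem_box => zW haz.
have {}zW : [/\ - W%:Z <= z.1, z.1 + 1 <= W%:Z, - W%:Z <= z.2 & z.2 + 1 <= W%:Z].
  by split; lia.
have [hx hy] := tiles_bound _ _ _ _ haz (f_geom a Ta).
have [hx' hy'] := tiles_bound _ _ _ _ hz' (f'_geom (h a) (hT a Ta)).
have dx := le_trans (coord_le_enorm _ ord0) (hC a Ta).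
have dy := le_trans (coord_le_enorm _ ord_max) (hC a Ta).
move: dx dy; rewrite !mxE !ler_norml => /andP[dx1 dx2] /andP[dy1 dy2].
move: hx hy hx' hy' zW => /andP[x1 x2] /andP[y1 y2] /andP[x3 x4] /andP[y3 y4].
rewrite mem_box -!(ltr_int R) -!(ler_int R).
rewrite !(rmorphD, rmorphM, rmorphN) /= -!pmulrn in x1 x2 y1 y2 x3 x4 y3 y4 *.
move=> [w1 w2 w3 w4].
have := ler_wpM2l (ltW alpha0) x3; have := ler_wpM2l (ltW alpha0) x4.
have := ler_wpM2l (ltW alpha0) y3; have := ler_wpM2l (ltW alpha0) y4.
rewrite !mulrDr => p1 p2 p3 p4.
have -> : z'.1%:~R < W'%:R :> R by rewrite -(ltr_pM2l alpha0); lra.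
have -> : z'.2%:~R < W'%:R :> R by rewrite -(ltr_pM2l alpha0); lra.
have -> : - W'%:R <= z'.1%:~R :> R by rewrite -(ler_pM2l alpha0); lra.
have -> : - W'%:R <= z'.2%:~R :> R by rewrite -(ler_pM2l alpha0); lra.
by [].
Qed.
End Displacement.

Definition dominated (alpha C : R) (c c' : cell -> bool) : Prop :=
  forall W W', W%:R + C + alpha < alpha * W'%:R ->
  (size (patch c (box W)) <= size (patch c' (box W')))%N.

Lemma BD_dominated c c' L L' :
  associated proto (tiling c) L -> associated proto (tiling c') L' -> BD L L' ->
  exists alpha C : R, [/\ 0 < alpha, 0 <= C, dominated alpha C c c'
                        & dominated alpha^-1 C c' c].
Proof.
move=> [f [fg [finj ->]]] [f' [fg' [finj' ->]]].
move=> [alpha [a0 [phi [C [hphi [phi_inj phi_surj]]]]]].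
have ha : alpha != 0 by rewrite gt_eqF.
(* One constant for both directions: undoing the dilation divides displacements by [alpha]. *)
pose D := Num.max `|C| (`|C| / alpha).
have CD : C <= D by rewrite le_max ler_norm.
have CD' : `|C| / alpha <= D by rewrite le_max lexx orbT.
have D0 : 0 <= D by rewrite le_max normr_ge0.
exists alpha, D; split=> //.
  have /choice[h hh] a : exists b, tiling c a ->
      tiling c' b /\ phi (f a) = alpha *: f' b.
    (* Outside the tiling the value of [h] is arbitrary. *)
    have [Ta|nTa] := pselect (tiling c a); last by exists a.
    have [[_ [b Tb <-] e] _] := hphi (f a) (imageP f Ta).
    by exists b.
  move=> W W'; apply: (displacement_size c c' f f' fg fg' alpha D h) => //.
  - by move=> a /hh[].
  - move=> a b Ta Tb e; apply: finj => //; apply: phi_inj; [by exists a|by exists b|].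
    by have [_ ->] := hh a Ta; have [_ ->] := hh b Tb; rewrite e.
  - move=> a Ta; have [_ <-] := hh a Ta.
    by apply: le_trans CD; apply: (hphi _ (imageP f Ta)).2.
have /choice[h hh] b : exists a, tiling c' b ->
    tiling c a /\ phi (f a) = alpha *: f' b.
  have [Tb|nTb] := pselect (tiling c' b); last by exists b.
  have [|x [[a Ta <-] e]] := phi_surj (alpha *: f' b).
    by exists (f' b) => //; exists b.
  by exists a.
have ai0 : 0 < alpha^-1 by rewrite invr_gt0.
move=> W W'; apply: (displacement_size c' c f' f fg' fg alpha^-1 D h) => //.
- by move=> b /hh[].
- move=> a b Ta Tb e; apply: finj' => //; apply: (scalerI ha).
  by have [_ <-] := hh a Ta; have [_ <-] := hh b Tb; rewrite e.
- move=> b Tb; have [Ta e] := hh b Tb.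
  have -> : f' b - alpha^-1 *: f (h b) = - alpha^-1 *: (f (h b) - phi (f (h b))).
    by rewrite e scalerBr !scaleNr scalerA mulVf // scale1r opprK addrC.
  have enormZ (t : R) x : enorm (t *: x) = `|t| * enorm x.
    rewrite /enorm -sqrtr_sqr -sqrtrM ?sqr_ge0 // mulr_sumr.
    by congr Num.sqrt; apply: eq_bigr => j _; rewrite mxE exprMn.
  rewrite enormZ normrN gtr0_norm // mulrC ler_pdivrMr //.
  have [_ hC] := hphi _ (imageP f Ta).
  by apply: le_trans hC (le_trans (ler_norm C) _); rewrite -ler_pdivrMr.
Qed.

(** * Comparing tile counts of the tilings *)

Section Equivalence.
Variable Q : nat.
Hypothesis Q_gt0 : (0 < Q)%N.
Local Notation N := (infl Q).

Lemma size_patch_box k W : size (patch (col Q k) (box W)) = tile_count Q k W.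
Proof. by rewrite size_patch size_rect /tile_count; congr addn; ring. Qed.

Lemma dominated_le1 (alpha C : R) k l : (k < Q)%N -> (l < Q)%N -> 0 <= C ->
  dominated alpha C (col Q k) (col Q l) -> alpha <= 1.
Proof.
move=> hk hl C0 hd; rewrite leNgt; apply/negP => a1.
(* This [v] makes [alpha * v - (v + 1) > 1], so dilating radius [v * N ^ m] by [alpha] overshoots
   [(v + 1) * N ^ m] by more than [N ^ m], and [N ^ m > m > C + alpha] absorbs the constants. *)
pose v := Num.bound ((alpha + 1) / (alpha - 1)).
have hv : alpha + 1 < (alpha - 1) * (v%:R + 1).
  rewrite mulrC -ltr_pdivrMr ?subr_gt0 //.
  apply: lt_le_trans (archi_boundP _) _; first by rewrite divr_ge0; lra.
  by rewrite lerDl.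
pose m := (second_eig Q * v.+1 ^ 2 + Num.bound (C + alpha)).+1.
have hm : C + alpha < m%:R.
  apply: lt_le_trans (archi_boundP _) _; first by rewrite addr_ge0 //; lra.
  by rewrite ler_nat /m; lia.
have hlm : (second_eig Q * v.+1 ^ 2 < m)%N by rewrite /m ltnS leq_addr.
have := tile_count_shrink Q Q_gt0 k l v.+1 m hk hl isT hlm.
rewrite /= ltnNge -!size_patch_box hd //.
have hN : m%:R < (N ^ m)%N%:R :> R by rewrite ltr_nat ltn_expl ?infl_gt1.
rewrite !natrM -natr1; move: (_ ^ m)%N%:R hN => y hN.
have {}hv : 1 < alpha * v%:R - (v%:R + 1) by lra.
have : 1 * y <= (alpha * v%:R - (v%:R + 1)) * y.
  by apply: ler_wpM2r (ltW hv); rewrite ltW // (le_lt_trans _ hN).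
rewrite mul1r; lra.
Qed.

Lemma dominated_leq (C : R) k l : (k < Q)%N -> (l < Q)%N -> 0 <= C ->
  dominated 1 C (col Q k) (col Q l) -> (k <= l)%N.
Proof.
move=> hk hl C0 hd; apply: (tile_count_shift Q Q_gt0 k l (Num.bound C).+1) => // m.
rewrite -!size_patch_box; apply: hd.
by have := archi_boundP C0; rewrite natrD -natr1; lra.
Qed.

Lemma BD_eq k l L L' : (k < Q)%N -> (l < Q)%N ->
  associated proto (tiling (col Q k)) L -> associated proto (tiling (col Q l)) L' ->
  BD L L' -> k = l.
Proof.
move=> hk hl hL hL' /(BD_dominated _ _ _ _ hL hL')[alpha [C [a0 C0 d1 d2]]].
have a1 := dominated_le1 _ _ _ _ hk hl C0 d1.
have a2 := dominated_le1 _ _ _ _ hl hk C0 d2.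
have ae : alpha = 1 by apply/le_anti; rewrite a1 -(invf_le1 a0).
rewrite ae invr1 in d1 d2; apply/eqP; rewrite eqn_leq.
by rewrite (dominated_leq _ _ _ hk hl C0 d1) (dominated_leq _ _ _ hl hk C0 d2).
Qed.
End Equivalence.
End Geometry.

Theorem theorem1p4 (R : realType) :
  exists (n : nat) (proto : 'I_n -> set 'rV[R]_2),
    (forall i, is_tile (proto i)) /\
    forall q : nat,
      exists (xi : 'I_q -> R)
             (rho : 'I_q -> 'I_n -> seq ('I_n * 'rV[R]_2))
             (T : 'I_q -> set ('I_n * 'rV[R]_2)),
        (forall k, is_subst proto (xi k) (rho k) /\
                   primitive (subst_matrix (rho k)) /\
                   in_hull proto (xi k) (rho k) (T k)) /\
        (forall k l, subst_matrix (rho k) = subst_matrix (rho l)) /\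
        (forall k l, k <> l ->
           forall Lk Ll : set 'rV[R]_2,
             Delone Lk -> associated proto (T k) Lk ->
             Delone Ll -> associated proto (T l) Ll ->
             ~ BD Lk Ll).
Proof.
exists 2, (proto R); split; first exact: proto_is_tile.
move=> q; have lt_q (k : 'I_q) : (k < q.+1)%N by exact: ltnW (ltn_ord k).
exists (fun=> (infl q.+1)%:R), (fun k => subst R q.+1 k).
exists (fun k => tiling R (col q.+1 k)); split=> [k|].
  split; first exact: is_subst_subst.
  by split; [exact: primitive_subst | exact: in_hull_tiling].
split=> [k l|k l ne L L' _ hL _ hL' hBD]; first exact: subst_matrix_subst.
by apply/ne/val_inj; apply: BD_eq hL hL' hBD => //=.
Qed.
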